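(* Let $\alpha$ be a finite set with an involution $\tau:\alpha\to\alpha$, let $k\ge1$, and let $P$ be a nanophrase of length $k$ over $\alpha$ with $2$ letters. Then $P$ is either homotopic to $(\emptyset|\cdots|\emptyset)$ (the nanophrase of length $k$ with all components empty) or isomorphic to $P^{1,1;p,q}_{a}$ for some $p,q\in\{1,\dots,k\}$ with $p<q$ and some $a\in\alpha$. Moreover, $P^{1,1;p,q}_{a}$ and $P^{1,1;p',q'}_{a'}$ are homotopic if and only if $p=p'$, $q=q'$ and $a=a'$.
   Context: Nanophrases. Fix a finite set $\alpha$ with an involution $\tau:\alpha\to\alpha$. An $\alpha$-alphabet is a set $\mathcal{A}$ with a map $\mathcal{A}\to\alpha$, $A\mapsto|A|$. A nanophrase of length $k$ over $\alpha$ is a pair $(\mathcal{A},(w_1|\cdots|w_k))$ with $\mathcal{A}$ an $\alpha$-alphabet and $w_1,\dots,w_k$ (possibly empty) words on $\mathcal{A}$ such that each element of $\mathcal{A}$ occurs exactly twice in the concatenation $w_1w_2\cdots w_k$. A nanophrase ''with $n$ letters'' means that $w_1\cdots w_k$ has length $n$ (so $\mathcal{A}$ has $n/2$ elements). The empty word is denoted $\emptyset$. Two nanophrases of length $k$ are isomorphic if there is a bijection of their alphabets preserving the maps to $\alpha$ and carrying the first sequence of words to the second. Homotopy. Homotopy of nanophrases of length $k$ is the equivalence relation generated by isomorphism and the following moves, where $x,y,z,t$ are words possibly including the separator ''$|$'', and every displayed two-letter subword lies inside a single component: (1) $(\mathcal{A},(xAAy))\to(\mathcal{A}\setminus\{A\},(xy))$;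 (2) $(\mathcal{A},(xAByBAz))\to(\mathcal{A}\setminus\{A,B\},(xyz))$ if $|B|=\tau(|A|)$; (3) $(\mathcal{A},(xAByACzBCt))\to(\mathcal{A},(xBAyCAzCBt))$ if $|A|=|B|=|C|$. (That is, $S$-homotopy with $S$ the diagonal of $\alpha\times\alpha\times\alpha$.) For $1\le p<q\le k$ and $a\in\alpha$, $P^{1,1;p,q}_a$ is the nanophrase of length $k$ with alphabet $\{A\}$, $|A|=a$, whose $p$-th and $q$-th components are the one-letter word $A$ and whose other components are empty. *)

(* Defs.v *)
From Stdlib Require Import Relation_Operators.
From mathcomp Require Import all_boot.

Set Implicit Arguments.
Unset Strict Implicit.
Unset Printing Implicit Defensive.

(* The alphabet may be taken to be a finType, since the condition that every
   letter occurs (exactly twice) in the words forces it to be finite. *)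
Record nanophrase (alpha : finType) (k : nat) := Nanophrase {
  alphabet : finType;
  proj : alphabet -> alpha;
  words : k.-tuple (seq alphabet);
  gauss : forall A : alphabet, count_mem A (flatten words) = 2
}.

Definition num_letters (alpha : finType) (k : nat) (P : nanophrase alpha k) :
  nat := size (flatten (words P)).

Definition isomorphic (alpha : finType) (k : nat) (P Q : nanophrase alpha k) :
  Prop :=
  exists f : alphabet P -> alphabet Q,
    [/\ bijective f,
        forall A, proj (f A) = proj A &
        map_tuple (map f) (words P) = words Q].

(* The sequence w_1|...|w_k as a single word, with None as the separator. *)
Definition barred (T : Type) (ws : seq (seq T)) : seq (option T) :=
  if ws is w :: ws' then
    map Some w ++ flatten [seq None :: map Some v | v <- ws']
  else [::].

(* x, y, z, t range over words that may contain separators. In the first two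
   moves the smaller alphabet is the subtype of the remaining letters, so its
   words are compared with xy (resp. xyz) through the inclusion val. The
   letters A, B, C are automatically distinct, each occurring only twice. *)
Inductive homotopy_move (alpha : finType) (tau : alpha -> alpha) (k : nat) :
  nanophrase alpha k -> nanophrase alpha k -> Prop :=
| Move1 (T : finType) (pr : T -> alpha) (A : T)
    (u : k.-tuple (seq T)) (v : k.-tuple (seq {L : T | L != A}))
    (gu : forall L, count_mem L (flatten u) = 2)
    (gv : forall L, count_mem L (flatten v) = 2)
    (x y : seq (option T)) :
    barred u = x ++ [:: Some A; Some A] ++ y ->
    map (omap val) (barred v) = x ++ y ->
    homotopy_move tau (Nanophrase pr gu)
      (Nanophrase (fun L : {L : T | L != A} => pr (val L)) gv)
| Move2 (T : finType) (pr : T -> alpha) (A B : T)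
    (u : k.-tuple (seq T)) (v : k.-tuple (seq {L : T | (L != A) && (L != B)}))
    (gu : forall L, count_mem L (flatten u) = 2)
    (gv : forall L, count_mem L (flatten v) = 2)
    (x y z : seq (option T)) :
    pr B = tau (pr A) ->
    barred u = x ++ [:: Some A; Some B] ++ y ++ [:: Some B; Some A] ++ z ->
    map (omap val) (barred v) = x ++ y ++ z ->
    homotopy_move tau (Nanophrase pr gu)
      (Nanophrase (fun L : {L : T | (L != A) && (L != B)} => pr (val L)) gv)
| Move3 (T : finType) (pr : T -> alpha) (A B C : T)
    (u v : k.-tuple (seq T))
    (gu : forall L, count_mem L (flatten u) = 2)
    (gv : forall L, count_mem L (flatten v) = 2)
    (x y z t : seq (option T)) :
    pr A = pr B -> pr B = pr C ->
    barred u = x ++ [:: Some A; Some B] ++ y ++ [:: Some A; Some C] ++ z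
                 ++ [:: Some B; Some C] ++ t ->
    barred v = x ++ [:: Some B; Some A] ++ y ++ [:: Some C; Some A] ++ z
                 ++ [:: Some C; Some B] ++ t ->
    homotopy_move tau (Nanophrase pr gu) (Nanophrase pr gv).

Definition homotopic (alpha : finType) (tau : alpha -> alpha) (k : nat) :
  nanophrase alpha k -> nanophrase alpha k -> Prop :=
  clos_refl_sym_trans (nanophrase alpha k)
    (fun P Q => isomorphic P Q \/ homotopy_move tau P Q).

Lemma empty_gauss (k : nat) (A : void) :
  count_mem A (flatten (nseq_tuple k [::])) = 2.
Proof. by case: A. Qed.

Definition empty_nanophrase (alpha : finType) (k : nat) : nanophrase alpha k :=
  Nanophrase (of_void alpha) (@empty_gauss k).

Definition words11 (k : nat) (p q : 'I_k) : k.-tuple (seq unit) :=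
  [tuple if (i == p) || (i == q) then [:: tt] else [::] | i < k].

Lemma words11_gauss (k : nat) (p q : 'I_k) (lt_pq : p < q) (A : unit) :
  count_mem A (flatten (words11 p q)) = 2.
Proof.
case: A; rewrite count_flatten -map_comp sumnE big_map big_enum /=.
have neq_qp : q != p by rewrite -val_eqE /= gtn_eqF.
rewrite (bigD1 p) // (bigD1 q) //= !eqxx orbT big1 // => i /andP[ip iq].
by rewrite (negPf ip) (negPf iq).
Qed.

(* The nanophrase P^{1,1;p,q}_a; components are indexed from 0 by 'I_k. *)
Definition nanophrase11 (alpha : finType) (k : nat) (p q : 'I_k)
    (lt_pq : p < q) (a : alpha) : nanophrase alpha k :=
  Nanophrase (fun _ : unit => a) (words11_gauss lt_pq).

(* Main.v *)
(** Fix components [p <> q] and call a letter linking when it occurs once in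
    each of them.  Moves (1) and (3) create or delete no linking letter, and
    move (2) deletes two letters that are both linking or both not, with opposite
    projections.  So the sum of [chi |A|] over the linking letters [A] is a
    homotopy invariant for every [chi] with values in an abelian group that
    satisfies [chi (tau b) = - chi b].  It vanishes on the empty nanophrase, and
    a suitable [chi] with values in [Z/4] tells apart all the [P^{1,1;p,q}_a]. *)

Require Import Defs.
From Stdlib Require Import Relation_Operators.
From mathcomp Require Import all_boot.
From mathcomp Require Import all_algebra.
From mathcomp Require Import zify.

Set Implicit Arguments.
Unset Strict Implicit.
Unset Printing Implicit Defensive.

Import GRing.Theory.

(** * Component indices in words with separators *)

Section Located.
Variable T : Type.

(* Pairs each letter with the index of its component, the first one being [n]. *)
Fixpoint located (n : nat) (s : seq (option T)) : seq (nat * T) :=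
  match s with
  | [::] => [::]
  | Some L :: s' => (n, L) :: located n s'
  | None :: s' => located n.+1 s'
  end.

Lemma located_cat n s t :
  located n (s ++ t) = located n s ++ located (n + count (negb \o isSome) s) t.
Proof.
elim: s n => [|[L|] s IHs] n /=; first by rewrite addn0.
  by rewrite IHs add0n.
by rewrite IHs addSnnS add1n.
Qed.

Lemma located_Some n w : located n (map Some w) = map (pair n) w.
Proof. by elim: w => //= L w ->. Qed.

Lemma count_bar_Some (w : seq T) : count (negb \o isSome) (map Some w) = 0.
Proof. by elim: w. Qed.

Lemma snd_located n s : map snd (located n s) = pmap id s.
Proof. by elim: s n => [|[L|] s IHs] n //=; rewrite IHs. Qed.

Lemma pmap_Some (w : seq T) : pmap id (map Some w) = w.
Proof. by elim: w => //= L w ->. Qed.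

Lemma pmap_barred (ws : seq (seq T)) : pmap id (barred ws) = flatten ws.
Proof.
case: ws => //= w ws; rewrite pmap_cat pmap_Some; congr (_ ++ _).
by elim: ws => //= v ws IHws; rewrite pmap_cat pmap_Some IHws.
Qed.

(** [x] and [y] are chosen before [w], so that the same context surrounds the factor [AA] and the
    empty word replacing it under move (1). *)
Lemma barred_update (ws1 ws2 : seq (seq T)) :
  exists x y, forall w, barred (ws1 ++ w :: ws2) = x ++ map Some w ++ y.
Proof.
case: ws1 => [|v ws1]; first by exists [::]; eexists=> w; reflexivity.
exists (barred (v :: ws1) ++ [:: None]); eexists=> w.
by rewrite /= map_cat flatten_cat /= -!catA.
Qed.

End Located.

Lemma barred_map (T U : Type) (f : T -> U) (ws : seq (seq T)) :
  barred (map (map f) ws) = map (omap f) (barred ws).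
Proof.
case: ws => //= w ws; rewrite map_cat -!map_comp map_flatten -map_comp.
by congr (_ ++ flatten _); apply: eq_map => x /=; rewrite -!map_comp.
Qed.

Lemma located_map (T U : Type) (f : T -> U) n s :
  located n (map (omap f) s) = [seq (i.1, f i.2) | i <- located n s].
Proof. by elim: s n => [|[L|] s IHs] n //=; rewrite IHs. Qed.

Lemma count_located_lt (T : eqType) n m (s : seq (option T)) L :
  m < n -> count_mem (m, L) (located n s) = 0.
Proof.
elim: s n => [|[K|] s IHs] n //= lt_mn; last exact/IHs/ltnW.
by rewrite xpair_eqE gtn_eqF // IHs.
Qed.

(** Each separator advances the index by one, so index [n + p] is reached in word [p] alone; past
    the last word the default [[::]] makes both sides 0. *)
Lemma count_located_barred (T : eqType) (ws : seq (seq T)) n p (L : T) :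
  count_mem (n + p, L) (located n (barred ws)) = count_mem L (nth [::] ws p).
Proof.
have countE m r w :
    count_mem (r, L) (map (pair m) w) = (r == m) * count_mem L w.
  rewrite count_map; case: (r =P m) => [->|ne_rm] /=; rewrite ?mul1n ?mul0n.
    by apply: eq_count => K /=; rewrite xpair_eqE eqxx.
  by rewrite -(count_pred0 w); apply: eq_count => K; apply/eqP=> -[/esym].
case: ws => [|w ws] /=; first by rewrite nth_nil.
rewrite located_cat count_cat located_Some count_bar_Some countE addn0.
rewrite -{2}[n]addn0 eqn_add2l.
(* Every remaining word is preceded by a separator: index [n] no longer occurs, and entry [p'] of
   [ws] has index [n + p'.+1]. *)
have ->: count_mem (n + p, L)
    (located n (flatten [seq None :: map Some v | v <- ws])) =
    if p is p'.+1 then count_mem L (nth [::] ws p') else 0.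
  elim: ws n p => [|v ws IHws] n p /=; first by case: p => // p; rewrite nth_nil.
  rewrite located_cat count_cat located_Some count_bar_Some countE addn0.
  case: p => [|p].
    by rewrite addn0 ltn_eqF // mul0n add0n count_located_lt.
  rewrite addnS -addSn IHws -{2}[n.+1]addn0 eqn_add2l.
  by case: p => [|p]; rewrite ?mul1n ?addn0.
by case: p => [|p]; rewrite ?mul1n ?addn0.
Qed.

(** * The linking sum and its invariance *)

Section Linking.
Variables (alpha : finType) (G : zmodType) (chi : alpha -> G) (p q : nat).

(* When [p != q], the product of multiplicities is 1 on the linking letters of a
   nanophrase and 0 on the other letters. *)
Definition linking (T : finType) (pr : T -> alpha) (s : seq (nat * T)) : G :=
  (\sum_L chi (pr L) *+ (count_mem (p, L) s * count_mem (q, L) s))%R.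

Definition phrase_linking k (P : nanophrase alpha k) : G :=
  linking (@proj _ _ P) (located 0 (barred (words P))).

Lemma perm_linking (T : finType) (pr : T -> alpha) s t :
  perm_eq s t -> linking pr s = linking pr t.
Proof. by move=> /permP eq_st; apply: eq_bigr => L _; rewrite !eq_st. Qed.

Lemma linking_inj (T U : finType) (pr : U -> alpha) (f : T -> U) s :
    injective f ->
  linking (pr \o f) s =
  (\sum_L chi (pr (f L)) *+ (count_mem (p, f L) [seq (i.1, f i.2) | i <- s]
                           * count_mem (q, f L) [seq (i.1, f i.2) | i <- s]))%R.
Proof.
move=> injf; apply: eq_bigr => L _; rewrite !count_map /=.
by congr (_ *+ (_ * _))%R; apply: eq_count => -[n K];
  rewrite /= !xpair_eqE (inj_eq injf).
Qed.

(** After a deleting move, this brings the sum over the smaller alphabet back to the original one,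
    where it can be compared term by term. *)
Lemma linking_sub (T : finType) (D : pred T) (pr : T -> alpha)
    (t : seq (nat * {L | D L})) :
  linking (fun L => pr (val L)) t =
  (\sum_(L | D L) chi (pr L) *+ (count_mem (p, L) [seq (i.1, val i.2) | i <- t]
                      * count_mem (q, L) [seq (i.1, val i.2) | i <- t]))%R.
Proof. by rewrite (linking_inj _ _ val_inj) (big_sub D). Qed.

Lemma isomorphic_linking k (P Q : nanophrase alpha k) :
  isomorphic P Q -> phrase_linking P = phrase_linking Q.
Proof.
case: P Q => [T pr u gu] [U pr' v gv] [/= f [bijf prf defv]].
rewrite /phrase_linking /= -defv /=.
rewrite barred_map located_map {2}/linking (reindex f) /=; last exact: onW_bij.
rewrite -(linking_inj _ _ (bij_inj bijf)).
by apply: eq_bigr => L _ /=; rewrite prf.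
Qed.

Lemma count_located0 (T : eqType) (s : seq (nat * T)) n L :
  count_mem L (map snd s) = 0 -> count_mem (n, L) s = 0.
Proof.
rewrite count_map => s0; apply/eqP; rewrite -leqn0 -s0.
by apply: sub_count => -[m K] /= /eqP[_ ->].
Qed.

Variable tau : alpha -> alpha.
Hypotheses (ne_pq : p != q) (chiN : forall b, chi (tau b) = (- chi b)%R).

Lemma move_linking k (P Q : nanophrase alpha k) :
  homotopy_move tau P Q -> phrase_linking P = phrase_linking Q.
Proof.
case=> [T pr A u v gu gv x y eu ev
       |T pr A B u v gu gv x y z prB eu ev
       |T pr A B C u v gu gv x y z t prAB prBC eu ev];
  rewrite /phrase_linking /=.
- have [n e1] : exists n, perm_eq (located 0 (barred u))
      ([:: (n, A); (n, A)] ++ located 0 (x ++ y)).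
    (* The separators in [x] give the index of the component containing [AA]. *)
    exists (count (negb \o isSome) x); apply/permP=> a.
    by rewrite eu !(located_cat, count_cat) /= !addn0 !add0n; lia.
  have := gu A.
  rewrite -pmap_barred -(snd_located 0) (permP (perm_map snd e1)).
  rewrite (perm_linking _ e1) linking_sub -located_map ev.
  move: (located _ _) => s /=.
  (* The deleted [AA] uses up both occurrences of [A], so none is left in [s]. *)
  rewrite !eqxx !addnA => /eqP; rewrite -[X in _ == X]addn0 eqn_add2l => /eqP s0.
  rewrite /linking (bigD1 A) //=.
  rewrite !count_located0 // !addn0 !xpair_eqE !eqxx !andbT.
  (* Both occurrences lie in component [n], which cannot be both [p] and [q]. *)
  have -> : ((n == p) + (n == p)) * ((n == q) + (n == q)) = 0.
    by case: eqP => [->|//]; rewrite (negPf ne_pq) muln0.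
  rewrite mulr0n add0r; apply: eq_bigr => L neLA.
  by rewrite !xpair_eqE ![A == L]eq_sym (negPf neLA) !andbF.
- have [n [m e1]] : exists n m, perm_eq (located 0 (barred u))
      ([:: (n, A); (n, B); (m, B); (m, A)] ++ located 0 (x ++ y ++ z)).
    exists (count (negb \o isSome) x).
    exists (count (negb \o isSome) x + count (negb \o isSome) y).
    apply/permP=> a; rewrite eu !(located_cat, count_cat) /= !addn0 !add0n.
    lia.
  have := gu A; have := gu B.
  rewrite -pmap_barred -(snd_located 0) !(permP (perm_map snd e1)).
  rewrite (perm_linking _ e1) linking_sub -located_map ev.
  move: (located _ _) => s /=.
  rewrite !eqxx => gB gA.
  (* Otherwise [A] would occur at least four times. *)
  have neBA : B != A by case: (B == A) gA.
  have neAB : A != B by rewrite eq_sym.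
  have sA : count_mem A (map snd s) = 0.
    by move: gA; rewrite (negPf neBA); case: count.
  have sB : count_mem B (map snd s) = 0.
    by move: gB; rewrite (negPf neAB); case: count.
  (* [A] and [B] each occur once at index [n] and once at index [m], so their terms have the same
     multiplicity and opposite values, and cancel. *)
  rewrite /linking (bigD1 A) //= (bigD1 B) //= prB chiN.
  rewrite !xpair_eqE !eqxx (negPf neAB) (negPf neBA) !andbT !andbF.
  rewrite !count_located0 // !addn0 !add0n mulNrn addrA subrr add0r.
  apply: eq_bigr => L /andP[neLA neLB].
  by rewrite !xpair_eqE ![A == L]eq_sym ![B == L]eq_sym
    (negPf neLA) (negPf neLB) !andbF.
(* Move (3) swaps neighbours with no separator between them, so each letter keeps its components. *)
- apply: perm_linking; apply/permP=> a; rewrite eu ev.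
  rewrite !(located_cat, count_cat) /= !addn0 !add0n; lia.
Qed.

Lemma homotopic_linking k (P Q : nanophrase alpha k) :
  homotopic tau P Q -> phrase_linking P = phrase_linking Q.
Proof.
elim=> {P Q} [P Q []||P Q _ ->|P Q R _ -> _ ->] //.
  exact: isomorphic_linking.
exact: move_linking.
Qed.

End Linking.

(** * An odd weight singling out one element of [alpha] *)

Section Weight.
Variables (alpha : finType) (tau : alpha -> alpha) (a : alpha).

(* The value at a fixed point of [tau] has to be an element of order 2. *)
Definition weight (b : alpha) : 'Z_4 :=
  (if b == a then if tau a == a then 2 else 1
   else if b == tau a then -1 else 0)%R.

Lemma weightN : involutive tau -> forall b, weight (tau b) = (- weight b)%R.
Proof.
move=> tauK b; rewrite /weight (can_eq tauK) (inv_eq tauK).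
case: (b =P a) => [->|neba].
  by rewrite eq_sym; case: (tau a == a); apply/val_inj.
case: (b =P tau a) neba => [->|_] neba; last by rewrite oppr0.
by rewrite opprK; case: eqP.
Qed.

Lemma weight_neq0 : weight a != 0%R.
Proof. by rewrite /weight eqxx; case: ifP. Qed.

(** Away from [a] only 0 and -1 are taken, and both differ from 1 and 2 modulo 4. Modulo 2, [a]
    could not be told from [tau a]. *)
Lemma weight_inj b : weight b = weight a -> b = a.
Proof.
by rewrite /weight eqxx; case: eqP => // _; case: ifP => _; case: ifP.
Qed.

End Weight.

(** * Nanophrases with two letters *)

Section OneLetter.
Variables (alpha : finType) (k : nat).

Lemma linking_empty (G : zmodType) (chi : alpha -> G) p q :
  phrase_linking chi p q (empty_nanophrase alpha k) = 0%R.
Proof. by rewrite /phrase_linking /linking big1 // => -[]. Qed.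

Lemma linking_nanophrase11 (G : zmodType) (chi : alpha -> G)
    (p q p' q' : 'I_k) (lt_pq : p < q) (lt_pq' : p' < q') a :
  phrase_linking chi p q (nanophrase11 lt_pq' a) =
  (if (p == p') && (q == q') then chi a else 0)%R.
Proof.
have countE (i : 'I_k) : count_mem (nat_of_ord i, tt)
    (located 0 (barred (words11 p' q'))) = (i == p') || (i == q').
  rewrite -[(i : nat)]add0n count_located_barred -tnth_nth tnth_mktuple.
  by case: ifP.
rewrite /phrase_linking /linking (big_pred1 tt) => [|[]//] /=.
rewrite !countE -!val_eqE /=.
(* Since [p < q] and [p' < q'], the two pairs can only match in order. *)
have -> : ((p == p' :> nat) || (p == q' :> nat)) *
          ((q == p' :> nat) || (q == q' :> nat)) =
          ((p == p' :> nat) && (q == q' :> nat)) :> nat.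
  by rewrite mulnb; congr nat_of_bool; lia.
by case: ifP.
Qed.

(** The invariant is tuned to [p], [q] and [a], so its value is nonzero and determines [a]; this
    serves both to exclude the empty nanophrase and to prove uniqueness. *)
Lemma homotopic_nanophrase11 (tau : alpha -> alpha) (P : nanophrase alpha k)
    (p q : 'I_k) (lt_pq : p < q) a :
    involutive tau -> homotopic tau (nanophrase11 lt_pq a) P ->
  phrase_linking (weight tau a) p q P = weight tau a a.
Proof.
move=> tauK hom.
rewrite -(homotopic_linking (tau := tau) _ _ hom) ?ltn_eqF //;
  last exact: weightN.
by rewrite linking_nanophrase11 // !eqxx.
Qed.

(** Move (1) deletes [A] and leaves the uninhabited alphabet [{L : T | L != A}]; an isomorphism then
    replaces it by [void]. *)
Lemma trivial_double (tau : alpha -> alpha) (T : finType) (pr : T -> alpha)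
    (A : T) (i : 'I_k) (w : k.-tuple (seq T))
    (g : forall L, count_mem L (flatten w) = 2) :
    (forall L, L = A) ->
    (forall j, tnth w j = if j == i then [:: A; A] else [::]) ->
  homotopic tau (Nanophrase pr g) (empty_nanophrase alpha k).
Proof.
move=> allA wE; pose v := nseq_tuple k (@nil {L : T | L != A}).
have noL (L : {L : T | L != A}) : False by case: L => L; rewrite (allA L) eqxx.
have gv (L : {L : T | L != A}) : count_mem L (flatten v) = 2 by case: (noL L).
have splitE U (w1 : seq U) : nseq i [::] ++ w1 :: nseq (k - i.+1) [::] =
    mkseq (fun j => if j == i then w1 else [::]) k.
  have sz : size (nseq i [::] ++ w1 :: nseq (k - i.+1) [::]) = k.
    by rewrite size_cat /= !size_nseq; have := ltn_ord i; lia.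
  apply: (@eq_from_nth _ [::]); rewrite sz ?size_mkseq // => j lt_jk.
  rewrite nth_mkseq // nth_cat size_nseq nth_nseq.
  case: ltngtP => [//|lt_ij|->]; last by rewrite subnn.
  by rewrite -(subnSK lt_ij) /= nth_nseq if_same.
have [x [y xyE]] := barred_update (nseq i (@nil T)) (nseq (k - i.+1) [::]).
apply: (rst_trans _ _ _ (Nanophrase (fun L : {L : T | L != A} => pr (val L)) gv)).
  apply/rst_step/or_intror/(@Move1 _ _ _ _ _ _ _ _ _ _ x y).
    rewrite -[[:: Some A; Some A]]/(map Some [:: A; A]) -xyE splitE.
    congr barred; apply: (@eq_from_nth _ [::]); rewrite size_tuple ?size_mkseq //.
    by move=> j lt_jk; rewrite nth_mkseq // -(tnth_nth _ _ (Ordinal lt_jk)) wE.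
  (* This is [xyE] with the empty word put in component [i]. *)
  have -> : x ++ y = barred (nseq k (@nil T)).
    rewrite -[y]cat0s -[[::]]/(map Some (@nil T)) -xyE splitE.
    congr barred; apply: (@eq_from_nth _ [::]); rewrite size_mkseq ?size_nseq //.
    by move=> j lt_jk; rewrite nth_mkseq // nth_nseq !if_same.
  by rewrite -barred_map map_nseq.
apply/rst_step/or_introl; exists (fun L => False_rect _ (noL L)).
split=> [|L|]; try by case: (noL L).
  by exists (of_void _) => [L|[]]; case: (noL L).
by apply: val_inj; rewrite /= map_nseq.
Qed.

Lemma isomorphic_nanophrase11 (T : finType) (pr : T -> alpha) (A : T)
    (p q : 'I_k) (lt_pq : p < q) (w : k.-tuple (seq T))
    (g : forall L, count_mem L (flatten w) = 2) :
    (forall L, L = A) ->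
    (forall i, tnth w i = if (i == p) || (i == q) then [:: A] else [::]) ->
  isomorphic (Nanophrase pr g) (nanophrase11 lt_pq (pr A)).
Proof.
move=> allA wE; exists (fun=> tt); split=> [|L|] /=.
- by exists (fun=> A) => [L|[]//]; rewrite (allA L).
- by rewrite (allA L).
by apply: eq_from_tnth => i; rewrite tnth_map tnth_mktuple wE; case: ifP.
Qed.

(** The component sizes add up to 2: either one component is [AA] and move (1) applies, or two
    components are [A], and sorting their indices gives [p < q]. *)
Lemma two_letters (tau : alpha -> alpha) (P : nanophrase alpha k) :
    num_letters P = 2 ->
  homotopic tau P (empty_nanophrase alpha k) \/
  exists (p q : 'I_k) (lt_pq : p < q) (a : alpha),
    isomorphic P (nanophrase11 lt_pq a).
Proof.
case: P => T pr w g; rewrite /num_letters /=.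
case defw: (flatten w) => [|A [|B []]] //= _.
(* The two available places are taken by the two occurrences of [A]. *)
have allA L : L = A.
  have := g L; have := g A; rewrite defw /= eqxx.
  by case: eqP => [->|//] _; case: eqP.
have wA (i : 'I_k) : tnth w i = nseq (size (tnth w i)) A.
  by apply/all_pred1P/allP => L _; apply/eqP.
have sum2 : \sum_(i < k) size (tnth w i) = 2.
  have := size_flatten w; rewrite defw /= => ->.
  by rewrite sumnE /shape big_map big_tuple.
have [i wi_gt0] : exists i, 0 < size (tnth w i).
  apply/existsP; apply: contraPT sum2 => /existsPn w0.
  by rewrite big1 // => i _; apply/eqP; rewrite -leqn0 leqNgt.
have := sum2; rewrite (bigD1 i) //=.
case wi: (size (tnth w i)) wi_gt0 => [|[|[|n]]] // _; last first.
  rewrite -[X in _ = X]addn0 => /addnI/eqP; rewrite sum_nat_eq0 => /forallP w0.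
  left; apply: (trivial_double tau pr (i := i) g allA) => j.
  have := w0 j; case: eqP => [->|_ /= /eqP/size0nil //] _.
  by rewrite wA wi.
case=> sum1.
have [j /andP[ne_ji wj_gt0]] : exists j, (j != i) && (0 < size (tnth w j)).
  apply/existsP; apply: contraPT sum1 => /existsPn w0.
  rewrite big1 // => j ne_ji; have := w0 j.
  by rewrite ne_ji /= -leqNgt leqn0 => /eqP.
move: sum1; rewrite (bigD1 j) //=.
case wj: (size (tnth w j)) wj_gt0 => [|[|n]] // _ [] /eqP.
rewrite sum_nat_eq0 => /forallP w0; right.
have wE l : tnth w l = if (l == i) || (l == j) then [:: A] else [::].
  have := w0 l; case: eqP => [->|_] /=; first by rewrite wA wi.
  by case: eqP => [->|_] /=; [rewrite wA wj|move/eqP/size0nil].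
case: (ltngtP i j) => [lt_ij|lt_ji|/val_inj eq_ij].
- by exists i, j, lt_ij, (pr A); apply: isomorphic_nanophrase11.
- exists j, i, lt_ji, (pr A); apply: isomorphic_nanophrase11 => // l.
  by rewrite wE orbC.
by rewrite eq_ij eqxx in ne_ji.
Qed.

End OneLetter.

Theorem theorem5p4 (alpha : finType) (tau : alpha -> alpha)
    (tauK : involutive tau) (k : nat) (k_ge1 : 1 <= k) :
  (forall P : nanophrase alpha k, num_letters P = 2 ->
     let trivial := homotopic tau P (empty_nanophrase alpha k) in
     let standard := exists (p q : 'I_k) (lt_pq : p < q) (a : alpha),
                       isomorphic P (nanophrase11 lt_pq a) in
     (trivial \/ standard) /\ ~ (trivial /\ standard)) /\
  (forall (p q p' q' : 'I_k) (lt_pq : p < q) (lt_pq' : p' < q')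
          (a a' : alpha),
     homotopic tau (nanophrase11 lt_pq a) (nanophrase11 lt_pq' a') <->
     [/\ p = p', q = q' & a = a']).
Proof.
split=> [P P2 trivial standard|p q p' q' lt_pq lt_pq' a a'].
  split; first exact: two_letters.
  (* The alternatives exclude each other: a standard form homotopic to the empty nanophrase would
     have invariant 0. *)
  case=> homP [p [q [lt_pq [a isoP]]]].
  have hom0 : homotopic tau (nanophrase11 lt_pq a) (empty_nanophrase alpha k).
    by apply: rst_trans homP; apply/rst_sym/rst_step/or_introl.
  have := homotopic_nanophrase11 tauK hom0.
  by rewrite linking_empty => /esym/eqP; apply/negP/weight_neq0.
split=> [hom|[eqp eqq eqa]].
  have := homotopic_nanophrase11 tauK hom; rewrite linking_nanophrase11 //.
  case: ifP => [/andP[/eqP-> /eqP->] /weight_inj-> //|_].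
  by move/esym/eqP; rewrite (negPf (weight_neq0 _ _)).
subst p' q' a'; rewrite (bool_irrelevance lt_pq' lt_pq); exact: rst_refl.
Qed.
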